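(* Let $m\ge1$ and let $(\mathbf R,\mathbf d)$ be a metric space. For each $N=(N_1,\dots,N_m)\in(\mathbb N^* )^m$ and each $j=1,\dots,m$, let $(h_j(N_j,\nu))_{0\le\nu\le N_j}$ be a strictly increasing sequence of elements of $[-1,1]$ (depending only on $j$ and $N_j$), and for $\nu\prec N$ let $h(N,\nu):=(h_1(N_1,\nu_1),\dots,h_m(N_m,\nu_m))\in[-1,1]^m$. Let $r=(r_1,\dots,r_m)\in(]1,+\infty])^m$ and let $\phi:(a,x)\mapsto\phi(a,x)\in\mathbb C$ be a continuous function on $\big(\prod_{j=1}^m]-r_j,r_j[\big)\times\mathbf R$. Suppose that, for each $x\in\mathbf R$, $a\mapsto\phi(a,x)$ is the restriction to $\prod_{j=1}^m]-r_j,r_j[$ of a complex valued function $f_x$ which is defined and holomorphic in the polydisc $$\mathbb D^m_{r+\mathbf 2}=\{w\in\mathbb C^m:|w_j|<r_j+2\text{ for }j=1,\dots,m\},$$ such that, for any compact subset $K$ of $\mathbf R$, $\{f_x: x\in K\}$ is a bounded family in $H(\mathbb D^m_{r+\mathbf 2})$. Then $$\phi(a,x)=\lim_{\{N\in(\mathbb N^* )^m:\ \min_j N_j\to+\infty\}}\ \sum_{\nu\prec N}\Bigg(\prod_{j=1}^m\ \prod_{\substack{\nu'=0\\ \nu'\ne\nu_j}}^{N_j}\frac{a_j-h_j(N_j,\nu')}{h_j(N_j,\nu_j)-h_j(N_j,\nu')}\Bigg)\,\phi(h(N,\nu),x)$$ uniformly in $(a,x)$ on any compact subset of $\big(\prod_{j=1}^m]-r_j,r_j[\big)\times\mathbf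 R$.
   Context: $\mathbb N^*$ is the set of positive integers. For $N\in(\mathbb N^* )^m$ and $\nu=(\nu_1,\dots,\nu_m)\in\mathbb N^m$, $\nu\prec N$ means $0\le\nu_j\le N_j$ for all $j$. $H(U)$ is the space of holomorphic functions on the open set $U$ with the topology of uniform convergence on compact subsets; a bounded family in $H(U)$ is one that is uniformly bounded on each compact subset of $U$. If $r_j=+\infty$ then $r_j+2=+\infty$. *)

(* Defs.v *)
From HB Require Import structures.
From mathcomp Require Import all_boot all_order all_algebra.
From mathcomp Require Import all_classical all_reals all_analysis.
From mathcomp Require Import complex.

Set Implicit Arguments.
Unset Strict Implicit.
Unset Printing Implicit Defensive.

Import Order.TTheory GRing.Theory Num.Theory.
Import numFieldNormedType.Exports.

Local Open Scope classical_set_scope.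
Local Open Scope ring_scope.
Local Open Scope complex_scope.

(* The library puts the normed-module structure (hence the topology and the
   uniformity) of [R[i]] over itself on the alias [R[i]^o] only. *)
HB.instance Definition _ (R : realType) := NormedModule.copy R[i] R[i]^o.

Definition open_box (R : realType) (m : nat) (r : 'I_m -> \bar R) :
    set 'rV[R]_m :=
  [set a | forall j, (- r j < (a 0 j)%:E < r j)%E].

(* [complex.Re `|z|] is the modulus of [z] as an element of [R]; the library's [`|z|]
   lives in [R[i]], with zero imaginary part. *)
Definition polydisc (R : realType) (m : nat) (r : 'I_m -> \bar R) :
    set 'rV[R[i]]_m :=
  [set w | forall j, ((complex.Re `|w 0 j|)%:E < r j)%E].

(* Complex differentiability at every point: the scalar field is [R[i]], so the
   differential is [R[i]]-linear. *)
Definition holomorphic_on (R : realType) (m : nat) (U : set 'rV[R[i]]_m)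
    (f : 'rV[R[i]]_m -> R[i]) : Prop :=
  forall w, U w -> differentiable f w.

Definition bounded_on_compacts (R : realType) (m : nat) (I : Type)
    (U : set 'rV[R[i]]_m) (A : set I) (f : I -> 'rV[R[i]]_m -> R[i]) : Prop :=
  forall L : set 'rV[R[i]]_m, compact L -> L `<=` U ->
    exists M : R, forall i w, A i -> L w -> complex.Re `|f i w| <= M.

(* The filter of [min_j N_j -> +oo] on the positive multi-indices [N]. *)
Definition multi_infty (m : nat) : set_system ('I_m -> nat) :=
  filter_from [set: nat]
    (fun n => [set N | forall j, (0 < N j)%N /\ (n <= N j)%N]).

Instance multi_infty_proper (m : nat) : ProperFilter (@multi_infty m).
Proof.
apply: filter_from_proper; last first.
  by move=> n _; exists (fun=> n.+1) => j; split.
apply: filter_from_filter; first by exists 0%N.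
move=> n p _ _; exists (maxn n p) => // N hN; split=> j;
  by have [N0] := hN j; rewrite geq_max => /andP[].
Qed.

Definition node (R : realType) (m : nat) (h : 'I_m -> nat -> nat -> R)
    (N : 'I_m -> nat) (nu : {dffun forall j : 'I_m, 'I_(N j).+1}) : 'rV[R]_m :=
  \row_j h j (N j) (nu j).

Definition lagrange_basis (R : realType) (m : nat)
    (h : 'I_m -> nat -> nat -> R) (N : 'I_m -> nat)
    (nu : {dffun forall j : 'I_m, 'I_(N j).+1}) (a : 'rV[R]_m) : R :=
  \prod_(j < m) \prod_(k < (N j).+1 | k != nu j)
    ((a 0 j - h j (N j) k) / (h j (N j) (nu j) - h j (N j) k)).

Definition lagrange_interp (R : realType) (m : nat) (X : Type)
    (h : 'I_m -> nat -> nat -> R) (phi : 'rV[R]_m * X -> R[i])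
    (N : 'I_m -> nat) (p : 'rV[R]_m * X) : R[i] :=
  \sum_(nu : {dffun forall j : 'I_m, 'I_(N j).+1})
    (lagrange_basis h nu p.1)%:C * phi (node h nu, p.2).

(* Main.v *)
Require Import Defs.
From HB Require Import structures.
From mathcomp Require Import all_boot all_order all_algebra.
From mathcomp Require Import all_classical all_reals all_analysis.
From mathcomp Require Import complex.
From mathcomp Require Import ring lra zify.
Import Order.TTheory GRing.Theory Num.Theory.
Import numFieldNormedType.Exports.
Local Open Scope classical_set_scope.
Local Open Scope ring_scope.
Local Open Scope complex_scope.

Set Implicit Arguments.
Unset Strict Implicit.
Unset Printing Implicit Defensive.

(** In one variable, Cauchy's formula at a point [a] with [|a| <= rho] and at
    the nodes, on the circle [|w| = t], writes the interpolation error of [f] as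
    the mean over that circle of
      [f w * (w / (w - a)) * \prod_i ((a - x_i) / (w - x_i))],
    because the Cauchy kernel is interpolated with an explicit remainder
    ([lagrange_kernel_remainder]).  The nodes lie in [-1, 1], so every factor of
    the product is at most [(rho + 1) / (t - 1)].  This is where the radius
    [r + 2] comes from: as [rho < r], one can take [rho + 2 < t < r + 2], the
    ratio is then smaller than 1, and the error decays geometrically, at a rate
    that depends on [f] only through a bound on the circle
    ([lagrange_remainder_le]).

    In several variables the norms of the one-dimensional interpolation
    operators may grow exponentially, so that the errors of the separate
    variables cannot simply be propagated through the remaining operators when
    the [N_j] are unrelated.  Instead, after [k] interpolated variables, the
    slice of the partial interpolant in the next variable is again holomorphic
    on the disc, and it is bounded on the circle because it is close to [f]
    there, where the next variable is complex.  Each variable thus multiplies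
    [1 + error] by one factor tending to 1 ([partial_interp_error]).

    Cauchy's formula is needed for functions that are only known to be complex
    differentiable at each point, but only in the form of a limit of means over
    the [2 ^ n]-th roots of unity: such means are linear and bounded by the
    supremum, which is all that the remainder estimate uses
    ([cauchy_formula]).  The circle is contracted towards [a] along
    [(l, w) |-> a + l * (w - a)] for [ep <= l <= 1], and Goursat's bisection is
    applied to Riemann sums of [f z dz / (z - a)] over the boundary of the
    parameter rectangle.  At every level of discretisation these sums are
    additive under subdivision and vanish exactly on affine functions, so the
    classical argument goes through without a theory of contour integrals
    ([goursat]). *)

(** * The real-valued modulus *)

(** The norm of [R[i]] takes its values in [R[i]], whose order is partial; all
    estimates are made in the totally ordered field [R]. *)
Definition cmod (R : realType) (z : R[i]) : R := complex.Re `|z|.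

Lemma normr_cmod (R : realType) (z : R[i]) : `|z| = (cmod z)%:C.
Proof. by rewrite /cmod RRe_real // normr_real. Qed.

Lemma cmod_ge0 (R : realType) (z : R[i]) : 0 <= cmod z.
Proof. by rewrite -lecR -normr_cmod normr_ge0. Qed.

Lemma cmod0 (R : realType) : cmod (0 : R[i]) = 0.
Proof. by rewrite /cmod normr0. Qed.

Lemma cmod1 (R : realType) : cmod (1 : R[i]) = 1.
Proof. by rewrite /cmod normr1. Qed.

Lemma cmod_eq0 (R : realType) (z : R[i]) : (cmod z == 0) = (z == 0).
Proof. by rewrite -(normr_eq0 z) normr_cmod -(inj_eq (@complexI R)). Qed.

Lemma cmod_gt0 (R : realType) (z : R[i]) : (0 < cmod z) = (z != 0).
Proof. by rewrite lt_def cmod_ge0 andbT cmod_eq0. Qed.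

Lemma cmodM (R : realType) (x y : R[i]) : cmod (x * y) = cmod x * cmod y.
Proof. by apply: complexI; rewrite rmorphM /= -!normr_cmod normrM. Qed.

Lemma cmodV (R : realType) (x : R[i]) : cmod x^-1 = (cmod x)^-1.
Proof. by apply: complexI; rewrite fmorphV /= -!normr_cmod normfV. Qed.

Lemma cmodX (R : realType) (x : R[i]) n : cmod (x ^+ n) = cmod x ^+ n.
Proof. by apply: complexI; rewrite rmorphXn /= -!normr_cmod normrX. Qed.

Lemma cmodN (R : realType) (x : R[i]) : cmod (- x) = cmod x.
Proof. by rewrite /cmod normrN. Qed.

Lemma cmodD (R : realType) (x y : R[i]) : cmod (x + y) <= cmod x + cmod y.
Proof. by rewrite -lecR rmorphD /= -!normr_cmod ler_normD. Qed.

Lemma cmodB (R : realType) (x y : R[i]) : cmod (x - y) <= cmod x + cmod y.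
Proof. by rewrite -(cmodN y) cmodD. Qed.

Lemma cmodBC (R : realType) (x y : R[i]) : cmod (x - y) = cmod (y - x).
Proof. by rewrite -cmodN opprB. Qed.

Lemma cmod_real (R : realType) (x : R) : cmod x%:C = `|x|.
Proof.
by rewrite /cmod normc_def /= expr0n /= addr0 sqrtr_sqr.
Qed.

Lemma cmod_nat (R : realType) n : cmod (n%:R : R[i]) = n%:R.
Proof. by rewrite -(rmorph_nat (real_complex R)) /= cmod_real normr_nat. Qed.

Lemma cmod_sum (R : realType) (I : Type) (s : seq I) (P : pred I)
    (F : I -> R[i]) :
  cmod (\sum_(i <- s | P i) F i) <= \sum_(i <- s | P i) cmod (F i).
Proof.
elim/big_rec2: _ => [|i u v _ vu]; first by rewrite cmod0.
by rewrite (le_trans (cmodD _ _)) // lerD2l.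
Qed.

Lemma cmod_prod (R : realType) (I : Type) (s : seq I) (P : pred I)
    (F : I -> R[i]) :
  cmod (\prod_(i <- s | P i) F i) = \prod_(i <- s | P i) cmod (F i).
Proof.
exact: (big_morph _ (@cmodM R) (@cmod1 R)).
Qed.

(** * Dyadic points on a circle *)

Definition cis (R : realType) (x : R) : R[i] := cos x +i* sin x.

Lemma cisD (R : realType) (x y : R) : cis (x + y) = cis x * cis y.
Proof.
apply/eqP; rewrite eq_complex /= cosD sinD eqxx /=.
by apply/eqP; ring. Qed.

Lemma cis0 (R : realType) : cis (0 : R) = 1.
Proof. by rewrite /cis cos0 sin0. Qed.

Lemma cis_pi (R : realType) : cis (pi : R) = -1.
Proof. by rewrite /cis cospi sinpi complexr0 rmorphN1. Qed.

Lemma cisMn (R : realType) (x : R) n : cis (x *+ n) = cis x ^+ n.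
Proof. by elim: n => [|n IH]; rewrite ?cis0 // mulrS cisD IH exprS. Qed.

Lemma cmod_cis (R : realType) (x : R) : cmod (cis x) = 1.
Proof.
by rewrite /cmod normc_def /= cos2Dsin2 sqrtr1.
Qed.

Lemma cmod_le_Re_Im (R : realType) (x y : R) : cmod (x +i* y) <= `|x| + `|y|.
Proof.
have -> : x +i* y = x%:C + 'i%C * y%:C by rewrite [LHS]complexE.
have i1 : cmod ('i%C : R[i]) = 1.
  by rewrite /cmod normc_def /= expr0n expr1n /= add0r sqrtr1.
by rewrite (le_trans (cmodD _ _)) // cmodM i1 mul1r !cmod_real.
Qed.

Lemma nonexpansive_of_is_derive (R : realType) (f df : R -> R) :
  (forall x : R, is_derive x 1 f (df x)) -> (forall x, `|df x| <= 1) ->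
  forall x y, `|f x - f y| <= `|x - y|.
Proof.
move=> fd df1 x y.
wlog xy : x y / y <= x.
  move=> W; have [|/ltW] := leP y x; first exact: W.
  by rewrite distrC (distrC x); exact: W.
have [|c _ ->] := @MVT_segment R f df y x xy (fun z _ => fd z).
  apply: continuous_subspaceT => z.
  by have [/derivable1_diffP/differentiable_continuous] := fd z.
by rewrite normrM ler_piMl.
Qed.

Lemma cis_lipschitz (R : realType) (x y : R) :
  cmod (cis x - cis y) <= `|x - y| *+ 2.
Proof.
have -> : cis x - cis y = (cos x - cos y) +i* (sin x - sin y) by [].
rewrite (le_trans (cmod_le_Re_Im _ _)) // mulr2n lerD //.
  apply: (@nonexpansive_of_is_derive R cos (fun z => - sin z)) => z.
  by rewrite normrN sin_max.
exact: (@nonexpansive_of_is_derive R sin cos _ (@cos_max R)).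
Qed.

Definition dyad (R : realType) (n j : nat) : R := j%:R / 2 ^+ n.

(** The parameter [x] counts turns, so that dyadic parameters give roots of
    unity. *)
Definition circle_pt (R : realType) (t : R) (x : R) : R[i] :=
  t%:C * cis (pi *+ 2 * x).

(** * Dyadic bisection *)

Lemma dyad0 (R : realType) n : dyad R n 0 = 0.
Proof. by rewrite /dyad mul0r. Qed.

Lemma dyad_top (R : realType) n : dyad R n (2 ^ n) = 1.
Proof. by rewrite /dyad natrX divff // expf_eq0 pnatr_eq0 andbF. Qed.

Lemma dyad_ge0 (R : realType) n j : 0 <= dyad R n j.
Proof. by rewrite /dyad divr_ge0 // exprn_ge0. Qed.

Lemma ler_dyad (R : realType) n i j : (i <= j)%N -> dyad R n i <= dyad R n j.
Proof. by move=> ij; rewrite /dyad ler_wpM2r ?invr_ge0 ?exprn_ge0 // ler_nat. Qed.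

Lemma dyad_refine (R : realType) n k j : dyad R (k + n) (j * 2 ^ n) = dyad R k j.
Proof.
rewrite /dyad natrM natrX exprD invfM mulrACA divff ?mulr1 //.
Qed.

Lemma dyadS (R : realType) n j : dyad R n j.+1 = dyad R n j + 2^-1 ^+ n.
Proof. by rewrite /dyad -natr1 mulrDl mul1r exprVn. Qed.

Definition in_dyad (R : realType) k j (x : R) := dyad R k j <= x <= dyad R k j.+1.

(** The left endpoints increase and stay below all right endpoints; their
    supremum is the common point. *)
Lemma nested_dyadic_point (R : realType) (c : nat -> nat) :
  c 0 = 0%N -> (forall k, ((c k).*2 <= c k.+1 <= (c k).*2.+1)%N) ->
  exists2 x : R, 0 <= x <= 1 & forall k, in_dyad k (c k) x.
Proof.
move=> c0 cS.
pose l k := dyad R k (c k); pose u k := dyad R k (c k).+1.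
have step k : l k <= l k.+1 /\ u k.+1 <= u k.
  have /andP[c1 c2] := cS k.
  by rewrite /l /u -(dyad_refine R 1 k) -(dyad_refine R 1 k (c k).+1) addn1 !expn1;
    split; apply: ler_dyad; lia.
have lmono k n : l k <= l (k + n)%N.
  by elim: n => [|n IH]; rewrite ?addn0 // addnS (le_trans IH) // (step _).1.
have umono k n : u (k + n)%N <= u k.
  by elim: n => [|n IH]; rewrite ?addn0 // addnS (le_trans (step _).2 IH).
have lu k n : l k <= u n.
  rewrite (le_trans (lmono k n)) // (le_trans _ (umono n k)) // addnC.
  exact: ler_dyad.
have ne : [set l k | k in setT] !=set0 by exists (l 0%N), 0%N.
have ub n : ubound [set l k | k in setT] (u n) by move=> _ [k _ <-].
have hs : has_sup [set l k | k in setT] by split => //; exists (u 0%N).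
exists (sup [set l k | k in setT]) => [|k]; apply/andP; split.
- apply: (@le_trans _ _ (l 0%N)); first by rewrite /l c0 dyad0.
  by apply: (sup_upper_bound hs); exists 0%N.
- apply: (@le_trans _ _ (u 0%N)); first exact: (ge_sup ne (ub 0%N)).
  by rewrite /u c0 -(dyad_top R 0).
- by apply: (sup_upper_bound hs); exists k.
- exact: (ge_sup ne (ub k)).
Qed.

(** If the unit square were bad, repeatedly passing to a bad quarter would
    produce nested bad cells shrinking to a point, near which all small cells
    are good. *)
Lemma dyadic_square_induction (R : realType) (good : nat -> nat -> nat -> Prop) :
  (forall k i j, good k.+1 i.*2 j.*2 -> good k.+1 i.*2.+1 j.*2 ->
     good k.+1 i.*2 j.*2.+1 -> good k.+1 i.*2.+1 j.*2.+1 -> good k i j) ->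
  (forall x y : R, 0 <= x <= 1 -> 0 <= y <= 1 ->
     exists k, forall i j, in_dyad k i x -> in_dyad k j y -> good k i j) ->
  good 0%N 0%N 0%N.
Proof.
move=> goodP good_near; apply: contrapT => bad0.
have child k (c : nat * nat) : exists c' : nat * nat,
    ~ good k c.1 c.2 ->
    [/\ ~ good k.+1 c'.1 c'.2, (c.1.*2 <= c'.1 <= c.1.*2.+1)%N &
        (c.2.*2 <= c'.2 <= c.2.*2.+1)%N].
  apply: contrapT => /forallNP nc.
  have bad : ~ good k c.1 c.2 by move=> g; apply: (nc (0, 0)%N).
  apply: bad; apply: goodP; apply: contrapT => b;
    [apply: (nc (c.1.*2, c.2.*2)) | apply: (nc (c.1.*2.+1, c.2.*2))
    | apply: (nc (c.1.*2, c.2.*2.+1)) | apply: (nc (c.1.*2.+1, c.2.*2.+1))];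
    by move=> _; split => //=; rewrite ?leqnn ?leqnSn.
pose next k c := sval (cid (child k c)).
have nextP k c := svalP (cid (child k c)).
pose cell := fix cell k := if k is k'.+1 then next k' (cell k') else (0, 0)%N.
have cell_bad k : ~ good k (cell k).1 (cell k).2.
  by elim: k => //= k /nextP[].
have [||x x01 xc] := @nested_dyadic_point R (fun k => (cell k).1) => //.
  by move=> k; have /nextP[] := cell_bad k.
have [||y y01 yc] := @nested_dyadic_point R (fun k => (cell k).2) => //.
  by move=> k; have /nextP[] := cell_bad k.
have [k kg] := good_near x y x01 y01.
exact: (cell_bad k (kg _ _ (xc k) (yc k))).
Qed.

(** * A discrete Goursat lemma *)

Definition cdifferentiable_at (R : realType) (f : R[i] -> R[i]) (z : R[i]) :=
  exists c : R[i], forall e : R, 0 < e -> exists2 d : R, 0 < d &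
    forall z', cmod (z' - z) < d ->
      cmod (f z' - f z - c * (z' - z)) <= e * cmod (z' - z).

Definition homothety (R : realType) (a : R[i]) (l w : R[i]) : R[i] :=
  a + l * (w - a).

(** The Riemann sum of [g z dz / (z - a)] over the boundary of the image of the
    grid rectangle [[p, q] x [u, v]] under the homotheties: along an arc [dz]
    is [l dw], so that [dz / (z - a)] is [dw / (w - a)], while along a ray it
    is [dl / l]. *)
Definition defect (R : realType) (a : R[i]) (L W : nat -> R[i])
    (g : R[i] -> R[i]) (p q u v : nat) : R[i] :=
  \sum_(u <= j < v) (g (homothety a (L q) (W j)) - g (homothety a (L p) (W j)))
     / (W j - a) * (W j.+1 - W j) -
  \sum_(p <= i < q) (g (homothety a (L i) (W v)) - g (homothety a (L i) (W u)))
     / L i * (L i.+1 - L i).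

Section Defect.
Context (R : realType) (a : R[i]) (L W : nat -> R[i]).
Implicit Types g : R[i] -> R[i].

Lemma defect_cat_rows g p r q u v : (p <= r <= q)%N ->
  defect a L W g p q u v = defect a L W g p r u v + defect a L W g r q u v.
Proof.
move=> /andP[pr rq]; rewrite /defect (big_cat_nat pr rq) /=.
rewrite addrACA -opprD; congr (_ - _); rewrite -big_split /=.
by apply: eq_bigr => j _; rewrite -!mulrDl; congr (_ / _ * _); ring.
Qed.

Lemma defect_cat_cols g p q u r v : (u <= r <= v)%N ->
  defect a L W g p q u v = defect a L W g p q u r + defect a L W g p q r v.
Proof.
move=> /andP[ur rv]; rewrite /defect (big_cat_nat ur rv) /=.
rewrite addrACA -opprD; congr (_ - _); rewrite -big_split /=.
by apply: eq_bigr => j _; rewrite -!mulrDl; congr (_ / _ * _); ring.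
Qed.

Lemma defectD g1 g2 p q u v :
  defect a L W (fun z => g1 z + g2 z) p q u v =
  defect a L W g1 p q u v + defect a L W g2 p q u v.
Proof.
rewrite /defect addrACA -opprD -!big_split /=; congr (_ - _);
  by apply: eq_bigr => j _; rewrite -!mulrDl; congr (_ / _ * _); ring.
Qed.

(** Constants integrate to the same sum along both arcs and along both rays.
    For [z - a = l * (w - a)] the integrands reduce to [dw] and [dl], whose sums
    telescope, and both pairs of sides give
    [(L q - L p) * (W v - W u)]. *)
Lemma defect_affine b c p q u v :
  (forall i, L i != 0) -> (forall j, W j != a) -> (p <= q)%N -> (u <= v)%N ->
  defect a L W (fun z => b + c * (z - a)) p q u v = 0.
Proof.
move=> L0 Wa pq uv; rewrite /defect /homothety.
under eq_bigr => j _.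
  rewrite (_ : _ * _ = c * (L q - L p) * (W j.+1 - W j)); last first.
    by field; rewrite subr_eq0 Wa.
  over.
under [X in _ - X]eq_bigr => i _.
  rewrite (_ : _ * _ = c * (W v - W u) * (L i.+1 - L i)); last first.
    by field; rewrite L0.
  over.
by rewrite -!mulr_sumr !telescope_sumr //; ring.
Qed.

Lemma cmod_defect_le g p q u v (e dl ep k : R) :
  0 < dl -> 0 < ep -> (p <= q)%N -> (u <= v)%N ->
  (forall i j, (p <= i <= q)%N -> (u <= j <= v)%N ->
     cmod (g (homothety a (L i) (W j))) <= e) ->
  (forall j, dl <= cmod (W j - a)) -> (forall i, ep <= cmod (L i)) ->
  (forall j, cmod (W j.+1 - W j) <= k) ->
  (forall i, cmod (L i.+1 - L i) <= k) ->
  cmod (defect a L W g p q u v) <=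
    e *+ 2 * k * ((v - u)%:R / dl + (q - p)%:R / ep).
Proof.
move=> dl0 ep0 pq uv ge Wdl Lep Wk Lk.
have e0 : 0 <= e by rewrite (le_trans (cmod_ge0 _) (ge p u _ _)) ?leqnn.
have k0 : 0 <= k by rewrite (le_trans (cmod_ge0 _) (Wk 0%N)).
have term (x y z d : R[i]) (m : R) : cmod x <= e -> cmod y <= e -> 0 < m ->
    m <= cmod z -> cmod d <= k -> cmod ((x - y) / z * d) <= e *+ 2 * k / m.
  move=> xe ye m0 mz dk; rewrite !cmodM cmodV mulrAC ler_pM //.
  - by rewrite mulr_ge0 ?cmod_ge0.
  - by rewrite invr_ge0 cmod_ge0.
  - rewrite ler_pM ?cmod_ge0 // mulr2n (le_trans (cmodB _ _)) // lerD //.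
  - by rewrite lef_pV2 // posrE // (lt_le_trans m0).
rewrite /defect (le_trans (cmodB _ _)) // mulrDr lerD //.
  rewrite (le_trans (cmod_sum _ _ _)) //.
  apply: (@le_trans _ _ (\sum_(u <= j < v) (e *+ 2 * k / dl))).
    rewrite big_nat [leRHS]big_nat; apply: ler_sum => j /andP[uj jv].
    by apply: term => //; apply: ge; rewrite ?leqnn ?pq ?uj ?(ltnW jv).
  rewrite big_const_nat iter_addr_0 -[_ *+ _]mulr_natr.
  by rewrite -!mulrA (mulrC dl^-1).
rewrite (le_trans (cmod_sum _ _ _)) //.
apply: (@le_trans _ _ (\sum_(p <= j < q) (e *+ 2 * k / ep))).
  rewrite big_nat [leRHS]big_nat; apply: ler_sum => j /andP[uj jv].
  by apply: term => //; apply: ge; rewrite ?leqnn ?uv ?uj ?(ltnW jv).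
rewrite big_const_nat iter_addr_0 -[_ *+ _]mulr_natr.
by rewrite -!mulrA (mulrC ep^-1).
Qed.

End Defect.

Lemma geometric_small (R : realType) (C q e : R) : 0 <= q < 1 -> 0 < e ->
  exists n0, forall n, (n0 <= n)%N -> C * q ^+ n <= e.
Proof.
move=> /andP[q0 q1] e0.
have : C * q ^+ n @[n --> \oo] --> C * 0.
  by apply: cvgMr; apply: cvg_expr; rewrite ger0_norm.
rewrite mulr0 => /cvgrPdist_le /(_ _ e0)[n0 _ H]; exists n0 => n nn0.
by have := H n nn0; rewrite /= sub0r normrN => /(le_trans (ler_norm _)).
Qed.

Definition segment_pt (R : realType) (e x : R) : R[i] := (e + (1 - e) * x)%:C.

Lemma cmod_circle_pt (R : realType) (t x : R) : 0 <= t -> cmod (circle_pt t x) = t.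
Proof. by move=> t0; rewrite cmodM cmod_cis cmod_real mulr1 ger0_norm. Qed.

Lemma circle_pt_lipschitz (R : realType) (t x y : R) : 0 <= t ->
  cmod (circle_pt t x - circle_pt t y) <= pi *+ 4 * t * `|x - y|.
Proof.
move=> t0; rewrite -mulrBr cmodM cmod_real (ger0_norm t0).
have := cis_lipschitz (pi *+ 2 * x) (pi *+ 2 * y).
have pi2 : 0 <= pi *+ 2 :> R by rewrite mulrn_wge0 // pi_ge0.
rewrite -mulrBr normrM (ger0_norm pi2) => H.
by rewrite (le_trans (ler_wpM2l t0 H)) // le_eqVlt; apply/orP; left;
  apply/eqP; ring.
Qed.

Lemma dyadic_cell_dist (R : realType) k n i j (x : R) : in_dyad k i x ->
  (i * 2 ^ n <= j <= i.+1 * 2 ^ n)%N ->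
  `|dyad R (k + n) j - x| <= 2^-1 ^+ k.
Proof.
move=> /andP[xl xu] /andP[/(ler_dyad R (k + n)) jl /(ler_dyad R (k + n)) ju].
move: jl ju xu; rewrite !dyad_refine dyadS => jl ju xu.
by rewrite ler_norml; apply/andP; split; lra.
Qed.

Section Goursat.
Context (R : realType) (a : R[i]) (t ep : R).
Hypotheses (at_lt : cmod a < t) (ep_gt0 : 0 < ep) (ep_le1 : ep <= 1).

Let t_ge0 : 0 <= t. Proof. exact: le_trans (cmod_ge0 a) (ltW at_lt). Qed.

Let Phi (x y : R) := homothety a (segment_pt ep x) (circle_pt t y).

Lemma segment_pt_ge (x : R) : 0 <= x -> ep <= cmod (segment_pt ep x).
Proof.
move=> x0; rewrite cmod_real ger0_norm.
  by rewrite lerDl mulr_ge0 // subr_ge0.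
by rewrite addr_ge0 ?(ltW ep_gt0) // mulr_ge0 // subr_ge0.
Qed.

Lemma circle_pt_dist (y : R) : t - cmod a <= cmod (circle_pt t y - a).
Proof.
rewrite lerBlDr -[leLHS](cmod_circle_pt y t_ge0).
by rewrite -{1}(subrK a (circle_pt t y)) cmodD.
Qed.

Lemma cmod_homothety_le (x y : R) : 0 <= x <= 1 -> cmod (Phi x y) <= t.
Proof.
move=> /andP[x0 x1]; rewrite /Phi /homothety /segment_pt.
set l := ep + _; set w := circle_pt t y.
have l0 : 0 <= l.
  by rewrite /l addr_ge0 ?(ltW ep_gt0) // mulr_ge0 // subr_ge0.
have l1 : l <= 1.
  rewrite -lerBrDl (le_trans (ler_wpM2l _ x1)) ?mulr1 // subr_ge0 //.
have -> : a + l%:C * (w - a) = (1 - l)%:C * a + l%:C * w.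
  by rewrite rmorphB rmorph1; ring.
have wt : cmod w = t by exact: cmod_circle_pt.
clearbody w; rewrite (le_trans (cmodD _ _)) // !cmodM !cmod_real wt.
rewrite ger0_norm ?subr_ge0 // (ger0_norm l0).
have : (1 - l) * cmod a <= (1 - l) * t by rewrite ler_wpM2l ?subr_ge0 // ltW.
lra.
Qed.

Lemma homothety_lipschitz (x y x' y' : R) : 0 <= x' <= 1 ->
  cmod (Phi x y - Phi x' y') <= t *+ 2 * `|x - x'| + pi *+ 4 * t * `|y - y'|.
Proof.
move=> /andP[x0 x1]; rewrite /Phi /homothety.
set w := circle_pt t y; set w' := circle_pt t y'.
have wt : cmod w = t by exact: cmod_circle_pt.
have ww : cmod (w - w') <= pi *+ 4 * t * `|y - y'| by exact: circle_pt_lipschitz.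
clearbody w w'.
have -> : a + segment_pt ep x * (w - a) - (a + segment_pt ep x' * (w' - a)) =
    (segment_pt ep x - segment_pt ep x') * (w - a) + segment_pt ep x' * (w - w').
  by ring.
rewrite (le_trans (cmodD _ _)) // !cmodM lerD //.
  rewrite mulrC ler_pM ?cmod_ge0 //.
    by rewrite (le_trans (cmodB _ _)) // wt mulr2n lerD2l ltW.
  rewrite /segment_pt -rmorphB cmod_real.
  rewrite (_ : _ - _ = (1 - ep) * (x - x')); last by ring.
  rewrite normrM ler_piMl // ger0_norm ?subr_ge0 //.
  by rewrite gerBl ltW.
rewrite -[leRHS]mul1r ler_pM ?cmod_ge0 //.
rewrite cmod_real ger0_norm; last first.
  by rewrite addr_ge0 ?(ltW ep_gt0) // mulr_ge0 // subr_ge0.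
by have := ep_gt0; have := ep_le1; nra.
Qed.

(** A cell is good when its defect is eventually at most [e] times its area
    [4 ^- k].  Bisection leaves only cells near a point [z] at which [f] differs
    from an affine function by [o(|w - z|)]: the affine part has no defect, the
    remainder is [o(2 ^- k)] on the cell, and the boundary has length
    [O(2 ^- k)]. *)
Lemma goursat (f : R[i] -> R[i]) :
  (forall z, cmod z <= t -> cdifferentiable_at f z) ->
  forall e : R, 0 < e -> exists n0, forall n, (n0 <= n)%N ->
    cmod (defect a (fun i => segment_pt ep (dyad R n i))
      (fun j => circle_pt t (dyad R n j)) f 0 (2 ^ n) 0 (2 ^ n)) <= e.
Proof.
move=> fd e e0.
pose D k n i j := defect a (fun i => segment_pt ep (dyad R (k + n) i))
   (fun j => circle_pt t (dyad R (k + n) j)) f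
   (i * 2 ^ n) (i.+1 * 2 ^ n) (j * 2 ^ n) (j.+1 * 2 ^ n).
pose good k i j := exists n0, forall n, (n0 <= n)%N ->
  cmod (D k n i j) <= e / 4 ^+ k.
suff [n0 H] : good 0%N 0%N 0%N.
  by exists n0 => n /H; rewrite /D expr0 divr1 add0n !mul0n !mul1n.
apply: (@dyadic_square_induction R) => [k i j [n1 H1] [n2 H2] [n3 H3] [n4 H4]|].
  exists (maxn (maxn n1 n2) (maxn n3 n4)).+1 => -[//|n].
  rewrite ltnS !geq_max => /andP[/andP[m1 m2] /andP[m3 m4]].
  have split4 : D k n.+1 i j = D k.+1 n i.*2 j.*2 + D k.+1 n i.*2.+1 j.*2 +
      (D k.+1 n i.*2 j.*2.+1 + D k.+1 n i.*2.+1 j.*2.+1).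
    have dbl x : (x * 2 ^ n.+1 = x.*2 * 2 ^ n)%N by rewrite expnS -muln2; lia.
    rewrite /D addnS addSn !dbl !doubleS.
    rewrite (@defect_cat_cols _ _ _ _ _ _ _ _ (j.*2.+1 * 2 ^ n)%N); last by nia.
    by congr (_ + _); apply: defect_cat_rows; nia.
  have := H1 n m1; have := H2 n m2; have := H3 n m3; have := H4 n m4.
  rewrite split4 => B4 B3 B2 B1.
  have -> : e / 4 ^+ k = (e / 4 ^+ k.+1 + e / 4 ^+ k.+1) +
                         (e / 4 ^+ k.+1 + e / 4 ^+ k.+1).
    by rewrite exprS; field; rewrite expf_eq0 pnatr_eq0 andbF.
  rewrite (le_trans (cmodD _ _)) // lerD //;
    by rewrite (le_trans (cmodD _ _)) // lerD.
move=> x y x01 y01.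
have /fd[c fc] := cmod_homothety_le y x01.
(* [C0] is a Lipschitz constant of the homotheties in the two parameters and
   [C2] one of the parametrisations of the sides. *)
pose C0 := t *+ 2 + pi *+ 4 * t; pose C2 := pi *+ 4 * t + 1.
pose dl := t - cmod a.
have dl0 : 0 < dl by rewrite subr_gt0.
have pi4t : 0 <= pi *+ 4 * t by rewrite mulr_ge0 // mulrn_wge0 // pi_ge0.
have C00 : 0 <= C0 by rewrite addr_ge0 // mulrn_wge0.
have C20 : 0 <= C2 by rewrite addr_ge0.
pose M := C0 *+ 2 * C2 * (dl^-1 + ep^-1) + 1.
have M0 : 0 < M.
  by rewrite ltr_wpDl // !mulr_ge0 ?mulrn_wge0 // addr_ge0 // invr_ge0 ltW.
have [d d0 fcd] := fc (e / M) (divr_gt0 e0 M0).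
have half01 : 0 <= (2^-1 : R) < 1 by lra.
have [k kd] := @geometric_small R C0 2^-1 (d / 2) half01 (divr_gt0 d0 (ltr0Sn _ 1)).
exists k => i j xi yj; exists 0%N => n _.
set z := Phi x y in fcd.
have close x' y' : `|x' - x| <= 2^-1 ^+ k -> `|y' - y| <= 2^-1 ^+ k ->
    cmod (Phi x' y' - z) <= C0 * 2^-1 ^+ k.
  move=> xx yy; rewrite (le_trans (homothety_lipschitz x' y' y x01)) //.
  by rewrite /C0 (mulrDl (t *+ 2)) lerD // ler_wpM2l // mulrn_wge0.
have fE : f = fun w => (f z + c * (a - z) + c * (w - a)) +
                       (f w - f z - c * (w - z)).
  by apply/funext => w; ring.
rewrite /D [X in defect _ _ _ X]fE defectD defect_affine ?add0r; first last.
- by rewrite leq_mul2r leqnSn orbT.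
- by rewrite leq_mul2r leqnSn orbT.
- move=> j'; rewrite -subr_eq0 -cmod_gt0 (lt_le_trans dl0) //.
  exact: circle_pt_dist.
- move=> i'; rewrite -cmod_gt0 (lt_le_trans ep_gt0) //.
  exact/segment_pt_ge/dyad_ge0.
have step m : `|dyad R (k + n) m.+1 - dyad R (k + n) m| = 2^-1 ^+ (k + n).
  by rewrite dyadS addrC addKr ger0_norm // exprn_ge0.
apply: (le_trans (@cmod_defect_le _ _ _ _ _ _ _ _ _ (e / M * (C0 * 2^-1 ^+ k))
    dl ep (C2 * 2^-1 ^+ (k + n)) dl0 ep_gt0 _ _ _ _ _ _ _)).
- by rewrite leq_mul2r leqnSn orbT.
- by rewrite leq_mul2r leqnSn orbT.
- move=> i' j' ii jj.
  have zd : cmod (Phi (dyad R (k + n) i') (dyad R (k + n) j') - z) <=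
      C0 * 2^-1 ^+ k.
    exact: close (dyadic_cell_dist xi ii) (dyadic_cell_dist yj jj).
  apply: (le_trans (fcd _ _)).
    by rewrite (le_lt_trans zd) // (le_lt_trans (kd k (leqnn k))) //; lra.
  by rewrite ler_wpM2l // divr_ge0 // ltW.
- move=> j'; exact: circle_pt_dist.
- move=> i'; exact/segment_pt_ge/dyad_ge0.
- move=> j'; rewrite (le_trans (circle_pt_lipschitz _ _ t_ge0)) // step.
  by rewrite ler_wpM2r ?exprn_ge0 // lerDl.
- move=> i'; rewrite /segment_pt -rmorphB cmod_real.
  rewrite (_ : _ - _ = (1 - ep) * (dyad R (k + n) i'.+1 - dyad R (k + n) i'));
    last by ring.
  rewrite normrM step ler_wpM2r ?exprn_ge0 // ger0_norm ?subr_ge0 //.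
  by rewrite (@le_trans _ _ 1) ?lerDr // gerBl ltW.
rewrite !mulSn !addnK natrX.
have -> : e / 4 ^+ k = e / M * (2^-1 ^+ k * 2^-1 ^+ k) * M.
  rewrite -exprMn -invfM -natrM exprVn; field.
  by rewrite (gt_eqF M0) expf_eq0 pnatr_eq0 andbF.
rewrite exprD.
have -> : 2^-1 ^+ n = (2 ^+ n)^-1 :> R by rewrite exprVn.
set h := 2^-1 ^+ k; set u := 2 ^+ n.
have u0 : u != 0 by rewrite expf_eq0 pnatr_eq0 andbF.
rewrite (_ : _ * _ = e / M * (h * h) * (C0 *+ 2 * C2 * (dl^-1 + ep^-1)));
  last by field; rewrite u0 (gt_eqF M0) (gt_eqF dl0) (gt_eqF ep_gt0).
rewrite ler_wpM2l ?lerDl // mulr_ge0 ?divr_ge0 ?(ltW e0) ?(ltW M0) //.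
by rewrite -expr2 sqr_ge0.
Qed.
End Goursat.

(** * Cauchy's formula for trapezoidal means *)

Definition circle_mean (R : realType) (t : R) (n : nat) (g : R[i] -> R[i]) : R[i] :=
  (\sum_(0 <= j < 2 ^ n) g (circle_pt t (dyad R n j))) / 2 ^+ n.

(** The kernel carries a factor [w] because [circle_mean] averages with respect
    to the angle, and [dw / (2 i pi)] is [w] times the normalised angular
    measure. *)
Definition cauchy_kernel (R : realType) (a w : R[i]) : R[i] := w / (w - a).

Section CircleMean.
Context (R : realType) (t : R) (n : nat).
Implicit Types g : R[i] -> R[i].

Lemma circle_meanD g1 g2 : circle_mean t n (fun w => g1 w + g2 w) =
  circle_mean t n g1 + circle_mean t n g2.
Proof. by rewrite /circle_mean big_split /= mulrDl. Qed.

Lemma circle_meanZ c g :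
  circle_mean t n (fun w => c * g w) = c * circle_mean t n g.
Proof. by rewrite /circle_mean -mulr_sumr mulrA. Qed.

Lemma circle_mean_sum (I : Type) (s : seq I) (P : pred I) (g : I -> R[i] -> R[i]) :
  circle_mean t n (fun w => \sum_(i <- s | P i) g i w) =
  \sum_(i <- s | P i) circle_mean t n (g i).
Proof. by rewrite /circle_mean exchange_big /= mulr_suml. Qed.

Lemma circle_mean_le g (B : R) : 0 <= t ->
  (forall w, cmod w = t -> cmod (g w) <= B) -> cmod (circle_mean t n g) <= B.
Proof.
move=> t0 gB; rewrite /circle_mean cmodM cmodV cmodX cmod_nat.
rewrite ler_pdivrMr ?exprn_gt0 // (le_trans (cmod_sum _ _ _)) //.
apply: (@le_trans _ _ (\sum_(0 <= j < 2 ^ n) B)).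
  by apply: ler_sum => j _; apply: gB; apply: cmod_circle_pt.
by rewrite big_const_nat iter_addr_0 subn0 -[_ *+ _]mulr_natr natrX.
Qed.

End CircleMean.

Lemma cmod_cauchy_kernel_le (R : realType) (a w : R[i]) (t : R) :
  cmod a < t -> cmod w = t -> cmod (cauchy_kernel a w) <= t / (t - cmod a).
Proof.
move=> at_lt wt; have d0 : 0 < t - cmod a by rewrite subr_gt0.
have dw : t - cmod a <= cmod (w - a).
  by rewrite lerBlDr -wt -{1}(subrK a w) cmodD.
rewrite cmodM cmodV wt ler_wpM2l ?lef_pV2 ?posrE ?(lt_le_trans d0) //.
exact: le_trans (cmod_ge0 a) (ltW at_lt).
Qed.

Lemma circle_ptN (R : realType) (t x : R) :
  circle_pt t (x + 2^-1) = - circle_pt t x.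
Proof.
rewrite /circle_pt mulrDr cisD (_ : pi *+ 2 * 2^-1 = pi) ?cis_pi; last by field.
by rewrite mulrN1 mulrN.
Qed.

Lemma circle_pt_sqr (R : realType) (t x : R) :
  circle_pt t x ^+ 2 = circle_pt (t ^+ 2) (x *+ 2).
Proof. by rewrite /circle_pt exprMn rmorphXn -cisMn mulrnAr. Qed.

Lemma circle_pt_step (R : realType) (t : R) n j :
  circle_pt t (dyad R n j.+1) - circle_pt t (dyad R n j) =
  (cis (pi *+ 2 / 2 ^+ n) - 1) * circle_pt t (dyad R n j).
Proof.
rewrite /circle_pt dyadS mulrDr cisD exprVn; ring.
Qed.

Lemma circle_pt0 (R : realType) (t : R) : circle_pt t 0 = t%:C.
Proof. by rewrite /circle_pt mulr0 cis0 mulr1. Qed.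

Lemma circle_pt1 (R : realType) (t : R) : circle_pt t 1 = t%:C.
Proof. by rewrite /circle_pt mulr1 cisMn cis_pi sqrrN expr1n mulr1. Qed.

(** The [2 ^ n] steps from [1] to its antipode add up to a chord of length
    2. *)
Lemma root_of_unity_gap (R : realType) n :
  2 <= cmod (cis (pi *+ 2 / 2 ^+ n.+1) - 1 : R[i]) * 2 ^+ n.
Proof.
have half : dyad R n.+1 (2 ^ n) = 0 + 2^-1.
  by rewrite -{1}(mul1n (2 ^ n)%N) -add1n dyad_refine dyadS dyad0 expr1.
have := telescope_sumr (fun j => circle_pt (1 : R) (dyad R n.+1 j)) (leq0n (2 ^ n)).
rewrite half circle_ptN dyad0 circle_pt0.
under eq_bigr do rewrite circle_pt_step.
rewrite -mulr_sumr => /(congr1 (@cmod R)).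
rewrite cmodM (_ : - (1%:C) - 1%:C = - (2%:R)) => [|]; last first.
  by rewrite rmorph1; ring.
rewrite cmodN cmod_nat => chord; rewrite -[leLHS]chord.
rewrite ler_wpM2l ?cmod_ge0 // (le_trans (cmod_sum _ _ _)) //.
rewrite (eq_bigr (fun=> 1)) => [|j _]; last by rewrite cmod_circle_pt.
by rewrite big_const_nat iter_addr_0 subn0 natrX.
Qed.

(** Averaging [w / (w - a)] over [w] and [- w] gives [w ^+ 2 / (w ^+ 2 - a ^+ 2)],
    so a mean over [2 ^ n.+1] points reduces to one over [2 ^ n] points with [t]
    and [a] squared. *)
Lemma circle_mean_kernel (R : realType) n (t : R) (a : R[i]) : cmod a < t ->
  circle_mean t n (cauchy_kernel a) * (t%:C ^+ (2 ^ n) - a ^+ (2 ^ n)) =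
  t%:C ^+ (2 ^ n).
Proof.
elim: n t a => [|n IH] t a at_lt.
  rewrite /circle_mean big_nat1 dyad0 circle_pt0 /cauchy_kernel !expr1.
  field; rewrite subr_eq0; apply: contraTneq at_lt => <-.
  by rewrite cmod_real -leNgt ler_norm.
have t0 : 0 <= t by apply: le_trans (cmod_ge0 a) (ltW at_lt).
have at2 : cmod (a ^+ 2) < t ^+ 2.
  by rewrite cmodX ltr_pXn2r ?nnegrE ?cmod_ge0.
have halve : circle_mean t n.+1 (cauchy_kernel a) =
    circle_mean (t ^+ 2) n (cauchy_kernel (a ^+ 2)).
  rewrite /circle_mean expnS mul2n -addnn.
  rewrite (@big_cat_nat _ _ _ (2 ^ n)) ?leq_addr //=.
  rewrite -{2}[(2 ^ n)%N]add0n big_addn addnK -big_split /= exprS invfM mulrA.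
  rewrite mulr_suml; congr (_ / _); apply: eq_bigr => j _.
  have -> : dyad R n.+1 (j + 2 ^ n) = dyad R n.+1 j + 2^-1.
    rewrite /dyad natrD natrX mulrDl; congr (_ + _).
    by rewrite exprS; field; rewrite expf_eq0 pnatr_eq0 andbF.
  have -> : dyad R n j = dyad R n.+1 j *+ 2.
    by rewrite /dyad exprS; field; rewrite expf_eq0 pnatr_eq0 andbF.
  rewrite circle_ptN -circle_pt_sqr /cauchy_kernel.
  have wt : cmod (circle_pt t (dyad R n.+1 j)) = t by exact: cmod_circle_pt.
  set w := circle_pt _ _ in wt *; clearbody w.
  have wa : w - a != 0.
    by rewrite subr_eq0; apply: contraTneq at_lt => <-; rewrite wt ltxx.
  have wNa : w + a != 0.
    rewrite addr_eq0; apply: contraTneq at_lt => wE.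
    by rewrite -(cmodN a) -wE wt ltxx.
  field; rewrite wa -opprD oppr_eq0 wNa /=.
  by rewrite (_ : _ - _ = (w - a) * (w + a)) ?mulf_neq0 //; ring.
by have := IH _ _ at2; rewrite halve expnS !exprM rmorphXn.
Qed.

Lemma circle_mean_kernel_cvg (R : realType) (t : R) (a : R[i]) : cmod a < t ->
  forall e : R, 0 < e -> exists n0, forall n, (n0 <= n)%N ->
    cmod (circle_mean t n (cauchy_kernel a) - 1) <= e.
Proof.
move=> at_lt e e0.
have t0 : 0 < t by apply: le_lt_trans (cmod_ge0 a) at_lt.
pose q := cmod a / t.
have q01 : 0 <= q < 1 by rewrite divr_ge0 ?cmod_ge0 ?ltW //= ltr_pdivrMr ?mul1r.
have [n0 H] := geometric_small (t / (t - cmod a)) q01 e0.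
exists n0 => n n0n; apply: le_trans (H n n0n).
have tN : t%:C ^+ (2 ^ n) != 0 :> R[i].
  by rewrite expf_neq0 // -cmod_gt0 cmod_real gtr0_norm.
have -> : circle_mean t n (cauchy_kernel a) - 1 =
    circle_mean t n (cauchy_kernel a) * (a / t%:C) ^+ (2 ^ n).
  apply: (mulIf tN); rewrite mulrBl mul1r -{2}(circle_mean_kernel n at_lt).
  by rewrite exprMn exprVn -[RHS]mulrA divfK //; ring.
rewrite cmodM cmodX cmodM cmodV cmod_real (gtr0_norm t0) -/q ler_pM ?cmod_ge0 //.
- by rewrite exprn_ge0 //; case/andP: q01.
- apply: circle_mean_le => [|w]; first exact: ltW.
  exact: cmod_cauchy_kernel_le.
- case/andP: q01 => qq0 /ltW q1; apply: ler_wiXn2l => //.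
  exact: ltnW (ltn_expl _ _).
Qed.

Lemma cdifferentiable_continuous (R : realType) (f : R[i] -> R[i]) z :
  cdifferentiable_at f z -> forall e : R, 0 < e -> exists2 d : R, 0 < d &
    forall z', cmod (z' - z) < d -> cmod (f z' - f z) <= e.
Proof.
move=> [c fc] e e0; have [d d0 H] := fc 1 ltr01.
have c1 : 0 < 1 + cmod c by rewrite ltr_pwDl // cmod_ge0.
exists (Num.min d (e / (1 + cmod c))) => [|z'].
  by rewrite lt_min d0 divr_gt0.
rewrite lt_min => /andP[/H zd /ltW]; rewrite ler_pdivlMr // => ze.
apply: le_trans ze; rewrite mulrDr mulr1.
rewrite -(subrK (c * (z' - z)) (f z' - f z)) (le_trans (cmodD _ _)) // lerD //.
  by rewrite mul1r in zd.
by rewrite cmodM mulrC.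
Qed.

(** Contracting the circle radially towards [a] does not change the discretised
    integral of [f dw / (w - a)] in the limit; near [a] the function is almost
    the constant [f a]. *)
Lemma circle_mean_sub_center (R : realType) (t : R) (a : R[i]) (f : R[i] -> R[i]) :
  cmod a < t -> (forall z, cmod z <= t -> cdifferentiable_at f z) ->
  forall e : R, 0 < e -> exists n0, forall n, (n0 <= n)%N ->
    cmod (circle_mean t n (fun w => (f w - f a) * cauchy_kernel a w)) <= e.
Proof.
move=> at_lt fd e e0.
have t0 : 0 < t by apply: le_lt_trans (cmod_ge0 a) at_lt.
pose B := t / (t - cmod a).
have B0 : 0 < B by rewrite divr_gt0 // subr_gt0.
have e2 : 0 < e / 2 by rewrite divr_gt0.
have [d d0 fcont] :=
  cdifferentiable_continuous (fd a (ltW at_lt)) (divr_gt0 e2 B0).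
(* [t *+ 3] exceeds every [|w - a|], so the contracted circle lies within [d] of
   [a]. *)
pose ep := Num.min 1 (d / (t *+ 3)).
have ep0 : 0 < ep by rewrite lt_min ltr01 divr_gt0 // pmulrn_lgt0.
have ep1 : ep <= 1 by rewrite ge_min lexx.
have epd : ep * (t *+ 3) <= d.
  by rewrite -ler_pdivlMr ?pmulrn_lgt0 // ge_min lexx orbT.
have [n1 H] := goursat at_lt ep0 ep1 fd e0.
exists n1.+1 => -[//|n]; rewrite ltnS => n1n.
pose shrink w := homothety a ep%:C w.
have -> : (fun w => (f w - f a) * cauchy_kernel a w) =
    fun w => (f w - f (shrink w)) * cauchy_kernel a w +
             (f (shrink w) - f a) * cauchy_kernel a w.
  by apply/funext => w; ring.
rewrite circle_meanD (_ : e = e / 2 + e / 2); last by field.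
rewrite (le_trans (cmodD _ _)) // lerD //; last first.
  apply: circle_mean_le => [|w wt]; first exact: ltW.
  rewrite cmodM -[leRHS](@divfK _ B) ?gt_eqF // ler_pM ?cmod_ge0 //.
    apply: fcont; rewrite /shrink /homothety addrAC subrr add0r cmodM cmod_real.
    rewrite gtr0_norm // (lt_le_trans _ epd) // ltr_pM2l //.
    rewrite (le_lt_trans (cmodB _ _)) // wt; move: at_lt; lra.
  exact: cmod_cauchy_kernel_le.
pose W j := circle_pt t (dyad R n.+1 j).
pose zeta : R[i] := cis (pi *+ 2 / 2 ^+ n.+1).
have seg0 : segment_pt ep (dyad R n.+1 0) = ep%:C.
  by rewrite /segment_pt dyad0 mulr0 addr0.
have seg1 : segment_pt ep (dyad R n.+1 (2 ^ n.+1)) = 1.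
  by rewrite /segment_pt dyad_top mulr1 addrC subrK.
(* The two rays bounding the parameter rectangle coincide, so only the outer and
   the inner circle contribute to the defect. *)
have {H} := H n.+1 (leqW n1n); rewrite /defect seg0 seg1.
rewrite dyad_top dyad0 circle_pt0 circle_pt1 [X in _ - X]big1 ?subr0; last first.
  by move=> i _; rewrite subrr !mul0r.
rewrite (eq_bigr (fun j => (zeta - 1) *
    ((f (W j) - f (shrink (W j))) * cauchy_kernel a (W j)))); last first.
  move=> j _; rewrite circle_pt_step -/zeta -/(W j).
  rewrite (_ : homothety a 1 (W j) = W j); last by rewrite /homothety; ring.
  by rewrite /cauchy_kernel /shrink; ring.
rewrite -mulr_sumr cmodM /circle_mean -/W; set S := \sum_(_ <= _ < _) _ => zS.
rewrite cmodM cmodV cmodX cmod_nat ler_pdivrMr ?exprn_gt0 //.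
have gap := root_of_unity_gap R n; rewrite -/zeta in gap.
have p0 : 0 < 2 ^+ n :> R by rewrite exprn_gt0.
have z0 : 0 < cmod (zeta - 1).
  by rewrite -(pmulr_lgt0 _ p0) (lt_le_trans _ gap).
rewrite -(ler_pM2l z0) (le_trans zS) // exprS.
have := ler_wpM2l (ltW e0) gap; lra.
Qed.

(** The difference [f w - f a] contributes nothing in the limit, and the
    constant [f a] is multiplied by the mean of the kernel, which tends to 1. *)
Lemma cauchy_formula (R : realType) (t : R) (a : R[i]) (f : R[i] -> R[i]) :
  cmod a < t -> (forall z, cmod z <= t -> cdifferentiable_at f z) ->
  forall e : R, 0 < e -> exists n0, forall n, (n0 <= n)%N ->
    cmod (circle_mean t n (fun w => f w * cauchy_kernel a w) - f a) <= e.
Proof.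
move=> at_lt fd e e0.
have e2 : 0 < e / 2 by rewrite divr_gt0.
have fa1 : 0 < 1 + cmod (f a) by rewrite ltr_pwDl // cmod_ge0.
have [n1 H1] := circle_mean_sub_center at_lt fd e2.
have [n2 H2] := circle_mean_kernel_cvg at_lt (divr_gt0 e2 fa1).
exists (maxn n1 n2) => n; rewrite geq_max => /andP[/H1 {}H1 /H2 {}H2].
have -> : (fun w => f w * cauchy_kernel a w) = fun w =>
    (f w - f a) * cauchy_kernel a w + f a * cauchy_kernel a w.
  by apply/funext => w; ring.
rewrite circle_meanD circle_meanZ -addrA.
rewrite (_ : f a * _ - f a = f a * (circle_mean t n (cauchy_kernel a) - 1));
  last by ring.
rewrite (le_trans (cmodD _ _)) // (_ : e = e / 2 + e / 2); last by field.
rewrite lerD // cmodM -[leRHS](@divfK _ (1 + cmod (f a))) ?gt_eqF //.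
by rewrite mulrC ler_pM ?cmod_ge0 // lerDr.
Qed.

(** * The remainder of one-dimensional Lagrange interpolation *)

Definition lagrange_weight (K : fieldType) n (x : 'I_n.+1 -> K)
    (i : 'I_n.+1) (a : K) : K :=
  \prod_(k < n.+1 | k != i) ((a - x k) / (x i - x k)).

(** This is the Lagrange interpolation of [1 / (w - y)] at [y = a], multiplied
    by [(w - a) * \prod_i (w - x i)].  As polynomials in [a], both sides have
    degree at most [n + 1], and they agree at the [n + 2] distinct points [w],
    [x 0], ..., [x n]. *)
Lemma lagrange_kernel_identity (K : fieldType) n (x : 'I_n.+1 -> K) (a w : K) :
  injective x -> (forall i, x i != w) ->
  \prod_i (w - x i) -
    \sum_i lagrange_weight x i a * ((w - a) * \prod_(k | k != i) (w - x k)) =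
  \prod_i (a - x i).
Proof.
move=> xinj xw.
pose L i : {poly K} :=
  (\prod_(k | k != i) (x i - x k)^-1) *: \prod_(k | k != i) ('X - (x k)%:P).
pose p : {poly K} := (\prod_i (w - x i))%:P -
  \sum_i (\prod_(k | k != i) (w - x k)) *: (L i * (w%:P - 'X)) -
  \prod_i ('X - (x i)%:P).
have Lhorner i y : (L i).[y] = lagrange_weight x i y.
  rewrite /L hornerZ horner_prod /lagrange_weight big_split /= mulrC.
  by congr (_ * _); apply: eq_bigr => k _; rewrite hornerXsubC.
have phorner y : p.[y] = \prod_i (w - x i) -
    \sum_i lagrange_weight x i y * ((w - y) * \prod_(k | k != i) (w - x k)) -
    \prod_i (y - x i).
  rewrite /p !hornerE horner_sum horner_prod; congr (_ - _ - _).
    apply: eq_bigr => i _.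
    by rewrite hornerZ hornerM Lhorner hornerD hornerN hornerC hornerX; ring.
  by apply: eq_bigr => k _; rewrite hornerXsubC.
suff p0 : p = 0.
  by have := phorner a; rewrite p0 horner0 => /eqP; rewrite eq_sym subr_eq0 => /eqP.
have szL i : (size (L i) <= n.+1)%N.
  rewrite /L (leq_trans (size_scale_leq _ _)) // -big_filter size_prod_XsubC.
  rewrite size_filter -[X in (_ <= X)%N](card_ord n.+1).
  have -> : count (fun k => k != i) (index_enum 'I_n.+1) = #|predC1 i|.
    by rewrite cardE /enum_mem size_filter; apply: eq_count => k.
  by rewrite cardC1 card_ord.
apply: (@roots_geq_poly_eq0 _ _ (w :: codom x)).
- rewrite /= /root phorner [X in _ - X - _]big1 => [|i _]; last by rewrite subrr mul0r mulr0.
  rewrite subr0 subrr eqxx /=; apply/allP => _ /codomP[j ->].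
  rewrite /root phorner.
  have wj (i : 'I_n.+1) : lagrange_weight x i (x j) = (i == j)%:R.
    rewrite /lagrange_weight; case: eqVneq => [->|ij].
      by apply: big1 => k kj; rewrite divff // subr_eq0 (inj_eq xinj) eq_sym.
    by rewrite (bigD1 j) 1?eq_sym //= subrr !mul0r.
  rewrite [X in _ - X - _](bigD1 j) //= [X in _ - (_ + X) - _]big1 => [|i ij]; last first.
    by rewrite wj (negbTE ij) mul0r.
  have -> : \prod_i (w - x i) = (w - x j) * \prod_(k | k != j) (w - x k).
    by rewrite (bigD1 j).
  rewrite wj eqxx mul1r addr0 subrr sub0r oppr_eq0.
  by rewrite (bigD1 j) //= subrr mul0r.
- rewrite /= map_inj_uniq ?enum_uniq // andbT; apply/negP => /codomP[i wi].
  by have := xw i; rewrite wi eqxx.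
- rewrite /= size_codom card_ord /p.
  have szw : (size (w%:P - 'X)%R <= 2)%N.
    by rewrite -opprB size_polyN size_XsubC.
  rewrite (leq_trans (size_polyD _ _)) // geq_max; apply/andP; split.
    rewrite (leq_trans (size_polyD _ _)) // geq_max; apply/andP; split.
      by rewrite (leq_trans (size_polyC_leq1 _)).
    rewrite size_polyN (leq_trans (size_sum _ _ _)) //; apply/bigmax_leqP => i _.
    rewrite (leq_trans (size_scale_leq _ _)) // (leq_trans (size_polyMleq _ _)) //.
    by rewrite -subn1 leq_subLR (leq_trans (leq_add (szL i) szw)) // addn2.
  rewrite size_polyN size_prod_XsubC /index_enum -enumT -cardT card_ord //.
Qed.

Lemma lagrange_kernel_remainder (R : realType) n (x : 'I_n.+1 -> R[i]) (a w : R[i]) :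
  injective x -> (forall i, x i != w) -> a != w ->
  cauchy_kernel a w - \sum_i lagrange_weight x i a * cauchy_kernel (x i) w =
  cauchy_kernel a w * \prod_i ((a - x i) / (w - x i)).
Proof.
move=> xinj xw aw.
have wa0 : w - a != 0 by rewrite subr_eq0 eq_sym.
have wx0 i : w - x i != 0 by rewrite subr_eq0 eq_sym.
have P0 : \prod_i (w - x i) != 0 by apply/prodf_neq0.
rewrite big_split /= prodfV -(lagrange_kernel_identity a xinj xw).
rewrite mulrBl divff // mulrBr mulr1; congr (_ - _).
rewrite mulr_suml mulr_sumr; apply: eq_bigr => i _.
have PE : \prod_k (w - x k) = (w - x i) * \prod_(k | k != i) (w - x k).
  by rewrite (bigD1 i).
rewrite PE in P0 *; rewrite /cauchy_kernel.
set Q := \prod_(k | _) _ in P0 *.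
have Q0 : Q != 0 by apply: contraNneq P0 => ->; rewrite mulr0.
by field; rewrite Q0 wa0 wx0.
Qed.

(** Cauchy's formula for [f] at [a] and at the nodes turns the interpolation
    error of [f] into the mean of [f] against the interpolation error of the
    Cauchy kernel, which is explicit. *)
Lemma lagrange_remainder_le (R : realType) n (x : 'I_n.+1 -> R[i])
    (f : R[i] -> R[i]) (a : R[i]) (rho t B : R) :
  injective x -> (forall i, cmod (x i) <= 1) -> 0 <= rho -> rho + 2 < t ->
  cmod a <= rho -> (forall z, cmod z <= t -> cdifferentiable_at f z) ->
  (forall w, cmod w = t -> cmod (f w) <= B) ->
  cmod (f a - \sum_i lagrange_weight x i a * f (x i)) <=
    B * (t / (t - rho)) * ((rho + 1) / (t - 1)) ^+ n.+1.
Proof.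
move=> xinj x1 rho0 rhot arho fd fB.
have at_lt : cmod a < t by lra.
have xt i : cmod (x i) < t by have := x1 i; lra.
set E := B * _ * _; apply/ler_addgt0Pr => e e0.
pose S := 1 + \sum_i cmod (lagrange_weight x i a).
have S0 : 0 < S by rewrite ltr_pwDl // sumr_ge0 // => i _; exact: cmod_ge0.
have [na Ha] := cauchy_formula at_lt fd (divr_gt0 e0 S0).
have /choice[nx Hx] : forall i, exists n0, forall n, (n0 <= n)%N ->
    cmod (circle_mean t n (fun w => f w * cauchy_kernel (x i) w) - f (x i)) <= e / S.
  by move=> i; apply: cauchy_formula => //; exact: divr_gt0.
pose N := maxn na (\max_i nx i).
have {}Ha := Ha N (leq_maxl _ _).
have {}Hx i : cmod (circle_mean t N (fun w => f w * cauchy_kernel (x i) w) - f (x i)) <= e / S.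
  by apply: Hx; rewrite (leq_trans _ (leq_maxr _ _)) // leq_bigmax.
pose M a' := circle_mean t N (fun w => f w * cauchy_kernel a' w).
have ME : cmod (M a - \sum_i lagrange_weight x i a * M (x i)) <= E.
  have -> : M a - \sum_i lagrange_weight x i a * M (x i) = circle_mean t N
      (fun w => f w * (cauchy_kernel a w -
         \sum_i lagrange_weight x i a * cauchy_kernel (x i) w)).
    have -> : (fun w => f w * (cauchy_kernel a w -
         \sum_i lagrange_weight x i a * cauchy_kernel (x i) w)) = (fun w =>
        f w * cauchy_kernel a w + (-1) *
         \sum_i lagrange_weight x i a * (f w * cauchy_kernel (x i) w)).
      apply/funext => w; rewrite mulrBr mulN1r mulr_sumr; congr (_ - _).
      by apply: eq_bigr => i _; rewrite mulrCA.
    rewrite circle_meanD circle_meanZ circle_mean_sum mulN1r; congr (_ - _).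
    by apply: eq_bigr => i _; rewrite circle_meanZ.
  apply: circle_mean_le => [|w wt]; first by lra.
  rewrite lagrange_kernel_remainder //; first last.
  - by apply: contraTneq at_lt => ->; rewrite wt ltxx.
  - by move=> i; apply: contraTneq (xt i) => ->; rewrite wt ltxx.
  rewrite cmodM (cmodM (cauchy_kernel a w)) mulrA.
  rewrite ler_pM ?mulr_ge0 ?cmod_ge0 //.
    rewrite ler_pM ?cmod_ge0 ?fB //.
    rewrite (le_trans (cmod_cauchy_kernel_le at_lt wt)) // ler_wpM2l //; first lra.
    by rewrite lef_pV2 ?posrE; lra.
  rewrite cmod_prod -[n.+1 in leRHS]card_ord -prodr_const; apply: ler_prod => i _.
  rewrite cmod_ge0 cmodM cmodV ler_pM ?invr_ge0 ?cmod_ge0 //.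
    by rewrite (le_trans (cmodB _ _)) // lerD.
  have wx : t - 1 <= cmod (w - x i).
    rewrite lerBlDr (le_trans _ (lerD (lexx _) (x1 i))) //.
    by rewrite -wt -{1}(subrK (x i) w) cmodD.
  by rewrite lef_pV2 ?posrE //; lra.
rewrite (_ : f a - _ = (M a - \sum_i lagrange_weight x i a * M (x i)) -
    ((M a - f a) - \sum_i lagrange_weight x i a * (M (x i) - f (x i)))); last first.
  under [X in _ - (_ - X)]eq_bigr do rewrite mulrBr.
  by rewrite sumrB; ring.
rewrite (le_trans (cmodB _ _)) // lerD // (le_trans (cmodB _ _)) //.
rewrite (_ : e = e / S + (S - 1) * (e / S)); last by field; rewrite gt_eqF.
rewrite lerD // {1}/S [1 + _]addrC addrK (le_trans (cmod_sum _ _ _)) //.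
rewrite mulr_suml; apply: ler_sum => i _.
by rewrite cmodM (ler_wpM2l (cmod_ge0 _) (Hx i)).
Qed.

(** * Interpolation one variable at a time *)

Definition set_coord (K : Type) m (p : 'rV[K]_m) (k : 'I_m) (z : K) : 'rV[K]_m :=
  \row_j (if j == k then z else p 0 j).

Lemma set_coordE (K : Type) m (p : 'rV[K]_m) (k : 'I_m) (z : K) j :
  set_coord p k z 0 j = if j == k then z else p 0 j.
Proof. by rewrite mxE. Qed.

Lemma set_coord_id (K : Type) m (p : 'rV[K]_m) (k : 'I_m) :
  set_coord p k (p 0 k) = p.
Proof. by apply/rowP => j; rewrite mxE; case: eqP => [->|]. Qed.

Lemma set_coord_set (K : Type) m (p : 'rV[K]_m) (k : 'I_m) (y z : K) :
  set_coord (set_coord p k y) k z = set_coord p k z.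
Proof. by apply/rowP => j; rewrite !mxE; case: eqP. Qed.

Section PartialInterpolation.
Context (K : fieldType) (m : nat) (N : 'I_m -> nat).
Context (x : forall j : 'I_m, 'I_(N j).+1 -> K) (f : 'rV[K]_m -> K).

Let multi_index := {dffun forall j : 'I_m, 'I_(N j).+1}.

Definition below (k : nat) (nu : multi_index) :=
  [forall j : 'I_m, (k <= j)%N ==> (nu j == ord0)].

Definition mixed_node (k : nat) (nu : multi_index) (a : 'rV[K]_m) : 'rV[K]_m :=
  \row_j (if (j < k)%N then x (nu j) else a 0 j).

(** Pinning the components of the multi-index from [k] on to [0] lets the sums
    for different [k] range over one type. *)
Definition partial_interp (k : nat) (a : 'rV[K]_m) : K :=
  \sum_(nu | below k nu)
    (\prod_(j < m | (j < k)%N) lagrange_weight (@x j) (nu j) (a 0 j)) *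
      f (mixed_node k nu a).

Definition set_index (k : 'I_m) (i : 'I_(N k).+1) (nu : multi_index) : multi_index :=
  [ffun j => @eqtype.dfwith _ (fun j => 'I_(N j).+1) (fun j => nu j) k i j].

Lemma set_index_in (k : 'I_m) (i : 'I_(N k).+1) nu : set_index i nu k = i.
Proof. by rewrite ffunE dfwith_in. Qed.

Lemma set_index_out (k j : 'I_m) (i : 'I_(N k).+1) nu :
  j != k -> set_index i nu j = nu j.
Proof. by move=> jk; rewrite ffunE dfwith_out // eq_sym. Qed.

Lemma partial_interp0 a : partial_interp 0 a = f a.
Proof.
pose nu0 : multi_index := [ffun j : 'I_m => (ord0 : 'I_(N j).+1)].
rewrite /partial_interp (big_pred1 nu0) => [|nu].
  rewrite big_pred0 // mul1r; congr f; apply/rowP => j.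
  by rewrite mxE ltn0.
apply/forallP/eqP => [H|-> j]; last by rewrite ffunE eqxx implybT.
by apply/ffunP => j; rewrite ffunE; apply/eqP; have := H j.
Qed.

(** A multi-index with components pinned from [k + 1] on is one with components
    pinned from [k] on, together with a free choice of its [k]-th component. *)
Lemma partial_interpS (k : 'I_m) a : partial_interp k.+1 a =
  \sum_i lagrange_weight (@x k) i (a 0 k) *
    partial_interp k (set_coord a k (x i)).
Proof.
rewrite /partial_interp (partition_big (fun nu : multi_index => nu k) xpredT) //=.
apply: eq_bigr => i _; rewrite mulr_sumr.
rewrite (reindex_onto (set_index i) (set_index (ord0 : 'I_(N k).+1))) /=; last first.
  move=> nu /andP[_ /eqP nuk]; apply/ffunP => j.
  have [->|jk] := eqVneq j k; first by rewrite set_index_in.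
  by rewrite !set_index_out.
apply: eq_big => [nu|nu /andP[/andP[nuk _] _]].
  rewrite set_index_in eqxx andbT; apply/andP/forallP => [[/forallP H /eqP Hk] j|H].
    have [->|jk] := eqVneq j k; first by rewrite -Hk set_index_in eqxx implybT.
    apply/implyP => kj; have := H j; rewrite set_index_out // => /implyP; apply.
    by rewrite ltn_neqAle kj andbT eq_sym.
  split.
    apply/forallP => j; apply/implyP => kj.
    have jk : j != k by rewrite neq_ltn kj orbT.
    by rewrite set_index_out //; have := H j; rewrite ltnW.
  apply/eqP/ffunP => j; have [->|jk] := eqVneq j k.
    by rewrite set_index_in; apply/esym/eqP; have := H k; rewrite leqnn.
  by rewrite !set_index_out.
rewrite (bigD1 k) //= set_index_in -mulrA; congr (_ * _); congr (_ * _).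
  apply: eq_big => [j|j /andP[_ jk]]; first by rewrite ltnS [RHS]ltn_neqAle andbC.
  by rewrite set_index_out // set_coordE (negbTE jk).
congr f; apply/rowP => j; rewrite !mxE ltnS [(j < k)%N]ltn_neqAle.
have [->|jk] := eqVneq j k; first by rewrite leqnn set_index_in eqxx.
by rewrite set_index_out //= (jk : (j != k :> nat)).
Qed.

End PartialInterpolation.

Lemma partial_interp_max (K : fieldType) m (N : 'I_m -> nat)
    (x : forall j : 'I_m, 'I_(N j).+1 -> K) (f : 'rV[K]_m -> K) a :
  partial_interp x f m a =
  \sum_(nu : {dffun forall j : 'I_m, 'I_(N j).+1})
    (\prod_j lagrange_weight (@x j) (nu j) (a 0 j)) * f (\row_j x j (nu j)).
Proof.
apply: eq_big => [nu|nu _].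
  by apply/forallP => j; rewrite leqNgt ltn_ord.
congr (_ * f _); first by apply: eq_bigl => j; rewrite ltn_ord.
by apply/rowP => j; rewrite !mxE ltn_ord.
Qed.

Lemma cdifferentiable_comb (R : realType) (I : Type) (s : seq I) (P : pred I)
    (c : I -> R[i]) (g : I -> R[i] -> R[i]) z :
  (forall i, P i -> cdifferentiable_at (g i) z) ->
  cdifferentiable_at (fun w => \sum_(i <- s | P i) c i * g i w) z.
Proof.
move=> gd; elim: s => [|i s [b IH]].
  exists 0 => e e0; exists 1 => // w _.
  by rewrite !big_nil subrr mul0r subrr cmod0 mulr_ge0 ?cmod_ge0 ?ltW.
case: (boolP (P i)) => [Pi|nPi]; last first.
  by exists b => e /IH[d d0 H]; exists d => // w /H; rewrite !big_cons (negbTE nPi).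
have [b' gi] := gd i Pi; exists (c i * b' + b) => e e0.
have e2 : 0 < e / 2 by rewrite divr_gt0.
have c1 : 0 < 1 + cmod (c i) by rewrite ltr_pwDl // cmod_ge0.
have [d1 d10 H1] := gi _ (divr_gt0 e2 c1); have [d2 d20 H2] := IH _ e2.
exists (Num.min d1 d2) => [|w]; first by rewrite lt_min d10.
rewrite lt_min => /andP[/H1 {}H1 /H2 {}H2]; rewrite !big_cons Pi.
set S := \sum_(_ <- _ | _) _ in H2 *; set S' := \sum_(_ <- _ | _) _ in H2 *.
rewrite (_ : _ - _ = c i * (g i w - g i z - b' * (w - z)) +
  (S - S' - b * (w - z))); last by ring.
rewrite (le_trans (cmodD _ _)) // (_ : e * _ = e / 2 * cmod (w - z) +
  e / 2 * cmod (w - z)); last by field.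
rewrite lerD // cmodM.
apply: le_trans (ler_wpM2l (cmod_ge0 _) H1) _.
rewrite mulrA ler_wpM2r ?cmod_ge0 // mulrCA ler_piMr ?(ltW e2) //.
by rewrite ler_pdivrMr // mul1r lerDr.
Qed.

(** For [|a| <= rho] and [|w| = t], the first factor bounds the Cauchy kernel
    and the second the product of the [(a - x i) / (w - x i)]. *)
Definition lagrange_error (R : realType) (rho t : R) (n : nat) : R :=
  t / (t - rho) * ((rho + 1) / (t - 1)) ^+ n.+1.

Lemma lagrange_error_ge0 (R : realType) (rho t : R) n :
  0 <= rho -> rho + 2 < t -> 0 <= lagrange_error rho t n.
Proof.
move=> rho0 rhot; rewrite mulr_ge0 ?exprn_ge0 // divr_ge0 //; lra.
Qed.

(** Passing from [k] to [k + 1] interpolated variables applies one-dimensional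
    interpolation to the slice of the partial interpolant, which is holomorphic
    and, by induction, bounded on the circle by the bound of [f] times the
    accumulated product; this is why the errors combine multiplicatively
    instead of being amplified by the norms of the interpolation operators. *)
Lemma partial_interp_error (R : realType) m (N : 'I_m -> nat)
    (x : forall j : 'I_m, 'I_(N j).+1 -> R[i]) (f : 'rV[R[i]]_m -> R[i])
    (rho t : 'I_m -> R) (M : R) :
  (forall j, injective (x j)) -> (forall j i, cmod (x j i) <= 1) ->
  (forall j, 0 <= rho j) -> (forall j, rho j + 2 < t j) ->
  (forall p : 'rV[R[i]]_m, (forall j, cmod (p 0 j) <= t j) -> cmod (f p) <= M) ->
  (forall (p : 'rV[R[i]]_m) k, (forall j, cmod (p 0 j) <= t j) ->
     cdifferentiable_at (fun z => f (set_coord p k z)) (p 0 k)) ->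
  forall k (a : 'rV[R[i]]_m), (k <= m)%N ->
    (forall j, cmod (a 0 j) <= t j) ->
    (forall j : 'I_m, (j < k)%N -> cmod (a 0 j) <= rho j) ->
    cmod (f a - partial_interp x f k a) <=
      M * (\prod_(j < m | (j < k)%N) (1 + lagrange_error (rho j) (t j) (N j)) - 1).
Proof.
move=> xinj x1 rho0 rhot fM fd; elim=> [|k IH] a km at_ arho.
  by rewrite partial_interp0 subrr cmod0 big_pred0 // subrr mulr0.
pose kk := Ordinal km.
set P := \prod_(j < m | (j < k)%N) _ in IH.
have Pk1 : \prod_(j < m | (j < k.+1)%N)
    (1 + lagrange_error (rho j) (t j) (N j)) =
    (1 + lagrange_error (rho kk) (t kk) (N kk)) * P.
  rewrite (bigD1 kk) //=; congr (_ * _); apply: eq_bigl => j.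
  by rewrite ltnS [RHS]ltn_neqAle andbC.
have slice_t z : cmod z <= t kk -> forall j, cmod (set_coord a kk z 0 j) <= t j.
  by move=> zt j; rewrite set_coordE; case: eqP => [->|].
have slice_rho z (j : 'I_m) : (j < k)%N -> cmod (set_coord a kk z 0 j) <= rho j.
  move=> jk; rewrite set_coordE; case: eqP => [jE|_]; last exact/arho/ltnW.
  by move: jk; rewrite jE ltnn.
pose g z := partial_interp x f k (set_coord a kk z).
have gE : g = fun z => \sum_(nu | below k nu)
    (\prod_(j < m | (j < k)%N) lagrange_weight (@x j) (nu j) (a 0 j)) *
      f (set_coord (mixed_node x k nu a) kk z).
  apply/funext => z; apply: eq_bigr => nu _; congr (_ * f _).
    apply: eq_bigr => j jk; rewrite set_coordE; case: eqP jk => // ->.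
    by rewrite ltnn.
  apply/rowP => j; rewrite !mxE; case: (eqVneq j kk) => // ->.
  by rewrite ltnn.
have gd z : cmod z <= t kk -> cdifferentiable_at g z.
  move=> zt; rewrite gE; apply: cdifferentiable_comb => nu _.
  have := fd (set_coord (mixed_node x k nu a) kk z) kk; rewrite set_coordE eqxx.
  under eq_fun do rewrite set_coord_set.
  apply=> j; rewrite set_coordE mxE; case: eqP => [->//|_]; case: ifP => // _.
  by rewrite (le_trans (x1 _ _)) //; have := rho0 j; have := rhot j; lra.
have gB w : cmod w = t kk -> cmod (g w) <= M * P.
  move=> wt; have wt' : cmod w <= t kk by rewrite wt.
  rewrite -(subrK (f (set_coord a kk w)) (g w)) (le_trans (cmodD _ _)) //.
  rewrite (_ : M * P = M * (P - 1) + M); last by ring.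
  rewrite lerD ?fM //; last exact: slice_t.
  by rewrite cmodBC IH ?(ltnW km) //; [exact: slice_t | exact: slice_rho].
have := lagrange_remainder_le (xinj kk) (x1 kk) (rho0 kk) (rhot kk)
  (arho kk (leqnn _)) gd gB.
rewrite /g set_coord_id -(partial_interpS x f kk a) => H.
rewrite -(subrK (partial_interp x f k a) (f a)) -addrA.
rewrite (le_trans (cmodD _ _)) // Pk1.
rewrite (_ : M * _ = M * (P - 1) + M * P * lagrange_error (rho kk) (t kk) (N kk));
  last by ring.
rewrite lerD //; last by rewrite /lagrange_error mulrA.
by rewrite IH ?(ltnW km) // => j jk; exact/arho/ltnW.
Qed.

(** By convexity [(1 + d) ^+ m <= 1 + d * (2 ^+ m - 1)] on [0, 1]. *)
Lemma prod_1D_le (R : realType) m (u : 'I_m -> R) (d : R) :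
  0 <= d <= 1 -> (forall j, 0 <= u j <= d) ->
  \prod_j (1 + u j) <= 1 + d * 2 ^+ m.
Proof.
move=> /andP[d0 d1] ud.
apply: (@le_trans _ _ (\prod_(j < m) (1 + d))).
  apply: ler_prod => j _; have /andP[u0 u1] := ud j.
  by rewrite lerD2l u1 andbT addr_ge0.
rewrite prodr_const card_ord.
have : (1 + d) ^+ m <= 1 + d * (2 ^+ m - 1).
  elim: m {u ud} => [|n IH]; first by rewrite !expr0 subrr mulr0 addr0.
  have p1 : 1 <= 2 ^+ n :> R by rewrite exprn_ege1 // ler1n.
  rewrite exprS (le_trans (ler_wpM2l _ IH)) ?addr_ge0 // exprS.
  move: (2 ^+ n) p1 => p p1; rewrite -subr_ge0.
  rewrite (_ : _ - _ = d * (1 - d) * (p - 1)); last by ring.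
  by rewrite !mulr_ge0 ?subr_ge0.
by move=> H; rewrite (le_trans H) // lerD2l ler_wpM2l // gerBl.
Qed.

Lemma lagrange_error_prod_cvg (R : realType) m (rho t : 'I_m -> R) (M e : R) :
  (forall j, 0 <= rho j) -> (forall j, rho j + 2 < t j) -> 0 < e ->
  exists n, forall N : 'I_m -> nat, (forall j, (n <= N j)%N) ->
    M * (\prod_j (1 + lagrange_error (rho j) (t j) (N j)) - 1) <= e.
Proof.
move=> rho0 rhot e0.
pose M' := 1 + `|M|.
have M0 : 0 < M' by rewrite ltr_pwDl.
have p0 : 0 < 2 ^+ m :> R by rewrite exprn_gt0.
pose d := Num.min 1 (e / (M' * 2 ^+ m)).
have d0 : 0 < d by rewrite lt_min ltr01 divr_gt0 // mulr_gt0.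
have /choice[n0 Hn] : forall j, exists n0, forall n, (n0 <= n)%N ->
    lagrange_error (rho j) (t j) n <= d.
  move=> j; have := rho0 j; have := rhot j => rt r0.
  have q01 : 0 <= (rho j + 1) / (t j - 1) < 1.
    by rewrite divr_ge0 ?ltr_pdivrMr ?mul1r; lra.
  have [n0 H] := geometric_small (t j / (t j - rho j)) q01 d0.
  by exists n0 => n n0n; apply/H/leqW.
exists (\max_j n0 j) => N HN.
have dle : \prod_j (1 + lagrange_error (rho j) (t j) (N j)) <= 1 + d * 2 ^+ m.
  apply: prod_1D_le => [|j]; first by rewrite ltW //= ge_min lexx.
  by rewrite lagrange_error_ge0 //= Hn // (leq_trans _ (HN j)) // leq_bigmax.
set Q := \prod_j _ in dle *.
have Q1 : 1 <= Q.
  apply: (big_ind (fun y => 1 <= y)) => // [y z|j _]; first exact: mulr_ege1.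
  by rewrite lerDl lagrange_error_ge0.
apply: (@le_trans _ _ (M' * (d * 2 ^+ m))).
  apply: (@le_trans _ _ (M' * (Q - 1))).
    by rewrite ler_wpM2r ?subr_ge0 // (le_trans (ler_norm _)) // lerDr.
  by rewrite ler_wpM2l ?(ltW M0) // lerBlDl.
rewrite mulrCA -ler_pdivlMr ?mulr_gt0 //.
by rewrite ge_min lexx orbT.
Qed.

(** * Topology of the complex plane and slices of holomorphic functions *)

Lemma slice_cdifferentiable (R : realType) m (f : 'rV[R[i]]_m -> R[i])
    (p : 'rV[R[i]]_m) (k : 'I_m) :
  differentiable f p -> cdifferentiable_at (fun z => f (set_coord p k z)) (p 0 k).
Proof.
move=> /diff_locally /eqaddoP df.
pose u : 'rV[R[i]]_m := delta_mx 0 k.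
pose s := complex.Re `|u|.
have uE : `|u| = s%:C by rewrite /s RRe_real // normr_real.
have s0 : 0 <= s by rewrite -lecR -uE normr_ge0.
have s1 : 0 < 1 + s by rewrite ltr_pwDl.
have coordE z : set_coord p k z = (z - p 0 k) *: u + p.
  apply/rowP => j; rewrite !mxE eqxx andTb.
  by case: eqP => [->|_]; rewrite ?mulr1 ?subrK // mulr0 add0r.
exists ('d f p u) => e e0.
have es : 0 < (e / (1 + s))%:C by rewrite -[0]/(0%:C) ltcR divr_gt0.
have /nbhs_normP[/= d d0 H] := df _ es.
have dE : d = (complex.Re d)%:C by rewrite RRe_real // gtr0_real.
have d0' : 0 < complex.Re d by rewrite -ltcR -dE.
exists (complex.Re d / (1 + s)) => [|z zd]; first by rewrite divr_gt0.
have := H ((z - p 0 k) *: u).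
rewrite /= sub0r normrN normrZ uE normr_cmod -rmorphM dE ltcR => /(_ _).
have zs : cmod (z - p 0 k) * s <= cmod (z - p 0 k) * (1 + s).
  by rewrite ler_wpM2l ?cmod_ge0 // lerDr.
move: (zd); rewrite ltr_pdivlMr // => /(le_lt_trans zs) zsd /(_ zsd).
rewrite !fctE /= set_coord_id -coordE linearZ /= -!rmorphM /= normr_cmod lecR.
rewrite opprD addrA -[_ *: _]/(_ * _) (mulrC (z - _)) => H1.
apply: (le_trans H1).
rewrite mulrAC -mulrA ler_wpM2l ?(ltW e0) // ler_pdivrMr //.
Qed.

(** The disc is a closed part of the image of the square [-t, t]^2 under the
    continuous map [(x, y) |-> x + i y]. *)
Lemma closed_disc_compact (R : realType) (t : R) :
  compact [set z : R[i] | cmod z <= t].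
Proof.
pose g (q : R * R) : R[i] := q.1 +i* q.2.
have gcont : continuous g.
  move=> q; apply/cvgrPdist_lt => e e0.
  have eE : e = (complex.Re e)%:C by rewrite RRe_real // gtr0_real.
  have e0' : 0 < complex.Re e / 2 by rewrite divr_gt0 // -ltcR -eE.
  near=> q'.
  have q1 : `|q.1 - q'.1| < complex.Re e / 2.
    near: q'; move: (_ / _) e0'; apply/cvgrPdist_lt; exact: cvg_fst.
  have q2 : `|q.2 - q'.2| < complex.Re e / 2.
    near: q'; move: (_ / _) e0'; apply/cvgrPdist_lt; exact: cvg_snd.
  rewrite normr_cmod eE ltcR.
  have -> : g q - g q' = (q.1 - q'.1) +i* (q.2 - q'.2) by [].
  by rewrite (le_lt_trans (cmod_le_Re_Im _ _)) // [ltRHS]splitr ltrD.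
apply: (@subclosed_compact _ _ (g @` (`[- t, t] `*` `[- t, t]))).
- rewrite -openC openE => z /= /negP; rewrite -ltNge => tz.
  apply/nbhs_normP; exists (cmod z - t)%:C.
    by rewrite /= -[0]/(0%:C) ltcR subr_gt0.
  move=> w /=; rewrite normr_cmod ltcR => zw; apply/negP; rewrite -ltNge.
  have := cmodD (z - w) w; rewrite subrK; lra.
- apply: continuous_compact; first exact: continuous_subspaceT.
  by apply: compact_setX; exact: segment_compact.
- move=> [b c] /= bct; exists (b, c) => //=; rewrite !in_itv /= -!ler_norml.
  move: bct; rewrite /cmod normc_def /= => bct.
  split; rewrite (le_trans _ bct) // -sqrtr_sqr ler_wsqrtr //.
    by rewrite lerDl sqr_ge0.
  by rewrite lerDr sqr_ge0.
Unshelve. all: by end_near.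
Qed.

Lemma closed_polydisc_compact (R : realType) m (t : 'I_m -> R) :
  compact [set p : 'rV[R[i]]_m | forall j, cmod (p 0 j) <= t j].
Proof.
by apply: (@rV_compact _ _ (fun j => [set z : R[i] | cmod z <= t j])) => j;
  exact: closed_disc_compact.
Qed.

Lemma compact_box_radius (R : realType) m (X : topologicalType)
    (r : 'I_m -> \bar R) (K : set ('rV[R]_m * X)) :
  (forall j, (1%:E < r j)%E) -> compact K -> K `<=` open_box r `*` [set: X] ->
  forall j, exists2 rho : R, (0 <= rho) /\ (rho%:E < r j)%E &
    forall q, K q -> `|q.1 0 j| <= rho.
Proof.
move=> r1 Kc Kr j.
have [K0|/nonemptyPn K0] := pselect (K !=set0); last first.
  exists 0 => [|q]; last by rewrite K0.
  by split => //; apply: lt_trans (r1 j); rewrite lte_fin.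
have fc : {within K, continuous (fun q : 'rV[R]_m * X => `|q.1 0 j|)}.
  apply: continuous_subspaceT => q.
  apply: (@continuous_comp _ _ _ (fun q : 'rV[R]_m * X => q.1 0 j) Num.norm).
    apply: (@continuous_comp _ _ _ fst (fun a : 'rV[R]_m => a 0 j)).
      exact: cvg_fst.
    exact: coord_continuous.
  exact: norm_continuous.
have [c] := compact_EVT_max K0 Kc fc; rewrite inE => Kc' cmax.
exists `|c.1 0 j|; last by move=> q Kq; apply: cmax; rewrite inE.
split=> //; have [/(_ j) + _] := Kr c Kc'.
case: (r j) => [s| |]; [|by move=> _; rewrite ltry|]; last first.
  by move=> /andP[_]; rewrite ltNge leNye.
by move=> H; rewrite lte_fin ltr_norml; move: H; rewrite -EFinN !lte_fin.
Qed.

(** * Uniform convergence on compact sets *)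

Lemma uniform_cvg_cmod (R : realType) (U : choiceType) (K : set U)
    (F : set_system (U -> R[i])) (g : U -> R[i]) : Filter F ->
  (forall e : R, 0 < e ->
     F [set u | forall q, K q -> cmod (g q - u q) < e]) ->
  {uniform K, F --> g}.
Proof.
move=> FF H P /uniform_nbhs[E [+ EP]].
rewrite -entourage_from_ballE => -[e /= e0 eE].
have eR : e = (complex.Re e)%:C by rewrite RRe_real // gtr0_real.
have /H : 0 < complex.Re e by rewrite -ltcR -eR.
apply: filterS => u He; apply: EP => q Kq; apply: eE => /=.
by rewrite -ball_normE /= normr_cmod eR ltcR; exact: He.
Qed.

Lemma real_lagrange_basis (R : realType) m (h : 'I_m -> nat -> nat -> R)
    (N : 'I_m -> nat) (nu : {dffun forall j : 'I_m, 'I_(N j).+1}) (a : 'rV[R]_m) :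
  (lagrange_basis h nu a)%:C = \prod_j
    lagrange_weight (fun i : 'I_(N j).+1 => (h j (N j) i)%:C) (nu j) (a 0 j)%:C.
Proof.
rewrite /lagrange_basis rmorph_prod; apply: eq_bigr => j _.
rewrite rmorph_prod; apply: eq_bigr => k _.
by rewrite fmorph_div !rmorphB.
Qed.

Unset Implicit Arguments.
Theorem theorem3p3 (R : realType) (m : nat) (m_gt0 : (0 < m)%N)
    (X : metricType R)
    (h : 'I_m -> nat -> nat -> R)
    (h_incr : forall (j : 'I_m) (n k l : nat),
       (0 < n)%N -> (k < l)%N -> (l <= n)%N -> h j n k < h j n l)
    (h_itv : forall (j : 'I_m) (n k : nat),
       (0 < n)%N -> (k <= n)%N -> -1 <= h j n k <= 1)
    (r : 'I_m -> \bar R) (r_gt1 : forall j, (1%:E < r j)%E)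
    (phi : 'rV[R]_m * X -> R[i])
    (phi_cont : {within open_box r `*` [set: X], continuous phi})
    (f : X -> 'rV[R[i]]_m -> R[i])
    (f_holo : forall x, holomorphic_on (polydisc (fun j => (r j + 2%:E)%E)) (f x))
    (f_phi : forall x a, open_box r a ->
       phi (a, x) = f x (map_mx (fun t : R => t%:C) a))
    (f_bound : forall K : set X, compact K ->
       bounded_on_compacts (polydisc (fun j => (r j + 2%:E)%E)) K f) :
  forall K : set ('rV[R]_m * X),
    compact K -> K `<=` open_box r `*` [set: X] ->
    {uniform K, lagrange_interp h phi @ @multi_infty m --> phi}.
Proof.
move=> K Kc Kr; apply: uniform_cvg_cmod => e e0.
have /choice[rho Hrho] : forall j, exists rho : R, [/\ 0 <= rho, (rho%:E < r j)%E &
    forall q, K q -> `|q.1 0 j| <= rho].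
  by move=> j; have [rho [rho0 rhor] H] := compact_box_radius r_gt1 Kc Kr j; exists rho.
have rho0 j : 0 <= rho j by have [] := Hrho j.
have Krho j q : K q -> `|q.1 0 j| <= rho j by have [_ _] := Hrho j; apply.
(* The circles have to lie inside the polydisc and to satisfy
   [(rho j + 1) / (t j - 1) < 1]. *)
have /choice[t Ht] : forall j, exists t : R,
    rho j + 2 < t /\ (t%:E < r j + 2%:E)%E.
  move=> j; have [_ + _] := Hrho j; case: (r j) => [s| |] //.
    rewrite lte_fin => rs; exists ((rho j + s) / 2 + 2).
    by rewrite -EFinD lte_fin; split; lra.
  by move=> _; exists (rho j + 3); rewrite addye // ltry; split => //; lra.
have rhot j : rho j + 2 < t j by have [] := Ht j.
pose L := [set p : 'rV[R[i]]_m | forall j, cmod (p 0 j) <= t j].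
have LU : L `<=` polydisc (fun j => (r j + 2%:E)%E).
  by move=> p Lp j; apply: le_lt_trans (Ht j).2; rewrite lee_fin; exact: Lp.
have KXc : compact (snd @` K).
  apply: continuous_compact Kc; apply: continuous_subspaceT => q.
  exact: cvg_snd.
have [M fM] := f_bound _ KXc L (closed_polydisc_compact (t := t)) LU.
have [n Hn] := lagrange_error_prod_cvg M rho0 rhot (divr_gt0 e0 (ltr0Sn _ 1)).
exists n => // N HN [a x] Kax.
have ar : open_box r a by have [] := Kr _ Kax.
pose xs j (i : 'I_(N j).+1) : R[i] := (h j (N j) i)%:C.
have hle j (i : 'I_(N j).+1) : -1 <= h j (N j) i <= 1.
  by apply: h_itv; [have [] := HN j | rewrite -ltnS].
have -> : phi (a, x) = f x (map_mx (fun t : R => t%:C) a) by exact: f_phi.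
have -> : lagrange_interp h phi N (a, x) =
    partial_interp xs (f x) m (map_mx (fun t : R => t%:C) a).
  rewrite partial_interp_max; apply: eq_bigr => nu _.
  rewrite real_lagrange_basis f_phi; last first.
    move=> j; rewrite mxE; have /andP[h1 h2] := hle j (nu j).
    have := r_gt1 j; case: (r j) => [s| |].
    - by rewrite -EFinN !lte_fin => s1; apply/andP; split; lra.
    - by move=> _; rewrite ltNyr ltry.
    - by rewrite ltNge leNye.
  congr (_ * f x _); first by apply: eq_bigr => j _; rewrite mxE.
  by apply/rowP => j; rewrite !mxE.
apply: (@le_lt_trans _ _ (e / 2)); last by lra.
apply: le_trans (Hn N _); last by move=> j; have [] := HN j.
have -> : \prod_j (1 + lagrange_error (rho j) (t j) (N j)) =
    \prod_(j < m | (j < m)%N) (1 + lagrange_error (rho j) (t j) (N j)).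
  by apply: eq_bigl => j; rewrite ltn_ord.
apply: partial_interp_error => //.
- move=> j i i' /complexI hh; apply: val_inj.
  have N0 : (0 < N j)%N by have [] := HN j.
  have [ii|ii|//] := ltngtP (val i) (val i').
    by have := h_incr j (N j) _ _ N0 ii; rewrite hh ltxx -ltnS => /(_ (ltn_ord _)).
  by have := h_incr j (N j) _ _ N0 ii; rewrite hh ltxx -ltnS => /(_ (ltn_ord _)).
- by move=> j i; rewrite cmod_real ler_norml; exact: hle.
- by move=> p Lp; apply: fM => //; exists (a, x).
- by move=> p k Lp; apply: slice_cdifferentiable; apply: f_holo; exact: LU.
- move=> j; rewrite mxE cmod_real (le_trans (Krho j _ Kax)) //.
  by have := rhot j; lra.
- by move=> j _; rewrite mxE cmod_real (Krho j _ Kax).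
Qed.
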